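(* Let $m\ge2$ be odd, $i\in\{1,\dots,(m-1)/2\}$ and $\delta\in\{1,-1\}$. Let $A$ be a graded $\Bbbk$-algebra generated in degree $1$ by $u$ and $v$, carrying a grading-preserving $\mathcal{A}_{4m}$-module algebra structure with $A_1=\Bbbk u\oplus\Bbbk v=\pi^\delta_i(u,v)$. Then the action of $\mathcal{A}_{4m}$ on $A$ is inner-faithful if and only if $\delta=-1$ and $(i,m)=1$.
   Context: Ground field $\Bbbk=\mathbb{C}$. An action of a Hopf algebra $H$ on an $H$-module algebra $A$ is inner-faithful if the only Hopf ideal $I$ of $H$ with $I\cdot A=0$ is $I=0$. $\mathcal{A}_{4m}$ (Masuoka), $m\ge2$: generated by $a,s_+,s_-$ with $a$ central and grouplike, $a^2=1$, $s_\pm^2=1$, $(s_+s_-)^m=1$. With $e_0=(1+a)/2$, $e_1=(1-a)/2$: $\Delta(s_\pm)=s_\pm\otimes e_0s_\pm+s_\mp\otimes e_1s_\pm$, $\epsilon(s_\pm)=1$, $S(s_\pm)=e_0s_\pm+e_1s_\mp$. It has dimension $4m$. With $\lambda=e^{2\pi\sqrt{-1}/m}$, $\pi^\delta_i(u,v)$ is the two-dimensional module with ordered basis $u,v$ and $s_+u=v$, $s_+v=u$, $s_-u=\lambda^iv$, $s_-v=\lambda^{-i}u$, $a$ acting by $\delta$. *)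

(* Defs.v *)
From HB Require Import structures.
From mathcomp Require Import all_boot all_order all_algebra all_field.
From mathcomp Require Import complex.
From mathcomp Require Import reals trigo.

Set Implicit Arguments.
Unset Strict Implicit.
Unset Printing Implicit Defensive.

Import GRing.Theory Num.Theory.
Local Open Scope ring_scope.

(* The tensor product of finite-dimensional spaces U and V is realised as the
   space of matrices of coordinates with respect to the products of the
   vectors of vbasis {:U} and vbasis {:V}. *)
Section Tensor.
Variable K : fieldType.
Implicit Types U V W : vectType K.

Definition tensor U V : vectType K := 'M[K]_(\dim {:U}, \dim {:V}).

Definition tens U V (u : U) (v : V) : tensor U V :=
  \matrix_(p, q) (coord (vbasis {:U}) p u * coord (vbasis {:V}) q v).

(* For bilinear B, tlift B t is the image of t under the linear map on the
   tensor product induced by B (see tliftE): in Sweedler notation, the sum of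
   the B t_1 t_2 for t = t_1 (x) t_2. *)
Definition tlift U V (W : lmodType K) (B : U -> V -> W) (t : tensor U V) : W :=
  \sum_p \sum_q (t : 'M_(_, _)) p q *: B (vbasis {:U})`_p (vbasis {:V})`_q.

(* The subspace X (x) Y of U (x) V. *)
Definition tensv U V (X : {vspace U}) (Y : {vspace V}) : {vspace tensor U V} :=
  <<[seq tens x y | x <- vbasis X, y <- vbasis Y]>>%VS.

Lemma tensDl U V (v : V) : {morph (fun u : U => tens u v) : x y / x + y}.
Proof. by move=> x y; apply/matrixP=> p q; rewrite !mxE linearD mulrDl. Qed.

Lemma tensDr U V (u : U) : {morph (fun v : V => tens u v) : x y / x + y}.
Proof. by move=> x y; apply/matrixP=> p q; rewrite !mxE linearD mulrDr. Qed.

Lemma tensZl U V c (u : U) (v : V) : tens (c *: u) v = c *: tens u v.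
Proof. by apply/matrixP=> p q; rewrite !mxE linearZ /= mulrA. Qed.

Lemma tensZr U V c (u : U) (v : V) : tens u (c *: v) = c *: tens u v.
Proof. by apply/matrixP=> p q; rewrite !mxE linearZ /= mulrCA. Qed.

Lemma tlift_linear U V (W : lmodType K) (B : U -> V -> W) : linear (tlift B).
Proof.
move=> c s t; rewrite /tlift scaler_sumr -big_split; apply: eq_bigr => p _ /=.
rewrite scaler_sumr -big_split; apply: eq_bigr => q _ /=.
by rewrite !mxE scalerDl scalerA.
Qed.

Lemma tliftE U V (W : lmodType K) (B : U -> V -> W) u v :
    (forall x, linear (B x)) -> (forall y, linear (B^~ y)) ->
  tlift B (tens u v) = B u v.
Proof.
move=> Br Bl.
pose fr x := HB.pack_for {linear V -> W} (B x)
  (GRing.isLinear.Build _ _ _ _ _ (Br x)).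
pose fl y := HB.pack_for {linear U -> W} (B^~ y)
  (GRing.isLinear.Build _ _ _ _ _ (Bl y)).
rewrite [in RHS](coord_vbasis (memvf u)) [in RHS](coord_vbasis (memvf v)).
rewrite -[RHS]/(fl _ _) linear_sum /tlift; apply: eq_bigr => p _.
rewrite linearZ -[fl _ _]/(fr _ _) linear_sum /= scaler_sumr.
apply: eq_bigr => q _.
by rewrite -[B _ (_ *: _)]/(fr _ _) linearZ mxE scalerA.
Qed.

Lemma memv_tens U V (X : {vspace U}) (Y : {vspace V}) x y :
  x \in X -> y \in Y -> tens x y \in tensv X Y.
Proof.
move=> Xx Yy; rewrite (coord_vbasis Xx) (coord_vbasis Yy).
rewrite (big_morph (fun u => tens u _) (@tensDl _ _ _) (id1 := 0)); last first.
  by apply/matrixP=> i j; rewrite !mxE linear0 mul0r.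
apply: memv_suml => p _.
rewrite (big_morph (fun v => tens _ v) (@tensDr _ _ _) (id1 := 0)); last first.
  by apply/matrixP=> i j; rewrite !mxE linear0 mulr0.
apply: memv_suml => q _.
rewrite tensZl tensZr !memvZ // memv_span //.
by apply: allpairs_f; apply: mem_nth; rewrite size_tuple.
Qed.

End Tensor.

Section HopfAlgebras.
Variable K : fieldType.

Definition tens1 (A B : falgType K) : tensor A B := tens 1 1.

(* Componentwise product: (x (x) y)(x' (x) y') = xx' (x) yy'. *)
Definition tmul (A B : falgType K) (s t : tensor A B) : tensor A B :=
  tlift (fun x y => tlift (fun x' y' => tens (x * x') (y * y')) t) s.

(* Finite-dimensional Hopf algebras. *)
Record hopfAlgebra := HopfAlgebra {
  hopf_sort :> falgType K;
  comul : {linear hopf_sort -> tensor hopf_sort hopf_sort};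
  counit : {lrmorphism hopf_sort -> K^o};
  antipode : {linear hopf_sort -> hopf_sort};
  comul1 : comul 1 = tens1 hopf_sort hopf_sort;
  comulM : forall g h, comul (g * h) = tmul (comul g) (comul h);
  (* both sides lie in H (x) (H (x) H) *)
  comulA : forall h,
    tlift (fun x y => tlift (fun x1 x2 => tens x1 (tens x2 y)) (comul x))
          (comul h)
    = tlift (fun x y => tens x (comul y)) (comul h);
  comul_counitl : forall h, tlift (fun x y => counit x *: y) (comul h) = h;
  comul_counitr : forall h, tlift (fun x y => counit y *: x) (comul h) = h;
  antipodel : forall h,
    tlift (fun x y => antipode x * y) (comul h) = counit h *: 1;
  antipoder : forall h,
    tlift (fun x y => x * antipode y) (comul h) = counit h *: 1
}.

Arguments comul {_}.
Arguments counit {_}.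
Arguments antipode {_}.

Variable H : hopfAlgebra.

Definition hopf_ideal (I : {vspace H}) : Prop :=
  [/\ forall x h, x \in I -> h * x \in I /\ x * h \in I,
      forall x, x \in I -> comul x \in (tensv I fullv + tensv fullv I)%VS,
      forall x, x \in I -> counit x = 0
    & forall x, x \in I -> antipode x \in I].

Definition grouplike (g : H) : Prop := comul g = tens g g /\ counit g = 1.

Record module_algebra (A : algType K) (act : H -> A -> A) : Prop := {
  act_linearr : forall h, linear (act h);
  act_linearl : forall x, linear (act^~ x);
  act_unit : forall x, act 1 x = x;
  act_mul : forall g h x, act (g * h) x = act g (act h x);
  act_onM : forall h x y,
    act h (x * y) = tlift (fun h1 h2 => act h1 x * act h2 y) (comul h);
  act_on1 : forall h, act h 1 = counit h *: 1
}.

Definition inner_faithful (A : algType K) (act : H -> A -> A) : Prop :=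
  forall I : {vspace H}, hopf_ideal I ->
    (forall h x, h \in I -> act h x = 0) -> I = 0%VS.

End HopfAlgebras.

Section Algebras.
Variables (K : fieldType) (A : algType K).

Definition generates (X : seq A) : Prop :=
  forall S : {pred A}, GRing.subalg_closed S -> {subset X <= S} ->
    forall x, x \in S.

Record graded (gr : nat -> {pred A}) : Prop := {
  gr_submod : forall n, GRing.submod_closed (gr n);
  gr_one : 1 \in gr 0%N;
  gr_mul : forall m n x y, x \in gr m -> y \in gr n -> x * y \in gr (m + n)%N;
  gr_sum : forall x, exists N (f : nat -> A),
    (forall n, f n \in gr n) /\ x = \sum_(n < N) f n;
  gr_direct : forall N (f : nat -> A), (forall n, f n \in gr n) ->
    \sum_(n < N) f n = 0 -> forall n, (n < N)%N -> f n = 0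
}.

(* S is the direct sum of the lines spanned by the nonzero vectors u and v. *)
Definition ordered_basis2 (S : {pred A}) (u v : A) : Prop :=
  (forall b c : K, b *: u + c *: v = 0 -> b = 0 /\ c = 0) /\
  (forall x, x \in S <-> exists b c : K, x = b *: u + c *: v).

End Algebras.

Arguments comul {K _}.
Arguments counit {K _}.
Arguments antipode {K _}.

Section Masuoka.
Variable K : fieldType.

Record A4m_relations (m : nat) (B : algType K) (a sp sm : B) : Prop := {
  A4m_asp : a * sp = sp * a;
  A4m_asm : a * sm = sm * a;
  A4m_a2 : a ^+ 2 = 1;
  A4m_sp2 : sp ^+ 2 = 1;
  A4m_sm2 : sm ^+ 2 = 1;
  A4m_spm : (sp * sm) ^+ m = 1
}.

Definition e0 (B : algType K) (a : B) : B := 2%:R^-1 *: (1 + a).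
Definition e1 (B : algType K) (a : B) : B := 2%:R^-1 *: (1 - a).

(* H is the Hopf algebra A_4m, with generators a, s_+ = sp and s_- = sm: the
   clauses A4m_rel, A4m_gen and A4m_univ say that its algebra is presented by
   the generators a, s_+, s_- and the relations A4m_relations. *)
Record is_A4m (m : nat) (H : hopfAlgebra K) (a sp sm : H) : Prop := {
  A4m_rel : A4m_relations m a sp sm;
  A4m_gen : generates [:: a; sp; sm];
  A4m_univ : forall (B : algType K) (b tp tm : B), A4m_relations m b tp tm ->
    exists f : {lrmorphism H -> B}, [/\ f a = b, f sp = tp & f sm = tm];
  A4m_a_grouplike : grouplike a;
  A4m_comul_sp :
    comul sp = tens sp (e0 a * sp) + tens sm (e1 a * sp);
  A4m_comul_sm :
    comul sm = tens sm (e0 a * sm) + tens sp (e1 a * sm);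
  A4m_counit_sp : counit sp = 1;
  A4m_counit_sm : counit sm = 1;
  A4m_antipode_sp : antipode sp = e0 a * sp + e1 a * sm;
  A4m_antipode_sm : antipode sm = e0 a * sm + e1 a * sp
}.

End Masuoka.

Definition lambda (R : realType) (m : nat) : R[i] :=
  (cos (2 * pi / m%:R) +i* sin (2 * pi / m%:R))%C.

(* The ordered pair (u, v) transforms under H = A_4m as the ordered basis of
   the module pi_i^delta(u, v). *)
Record pi_action (R : realType) (m i : nat) (delta : R[i])
    (H : hopfAlgebra R[i]) (a sp sm : H) (A : algType R[i])
    (act : H -> A -> A) (u v : A) : Prop := {
  pi_sp_u : act sp u = v;
  pi_sp_v : act sp v = u;
  pi_sm_u : act sm u = lambda R m ^+ i *: v;
  pi_sm_v : act sm v = lambda R m ^- i *: u;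
  pi_a_u : act a u = delta *: u;
  pi_a_v : act a v = delta *: v
}.

(* Main.v *)
From HB Require Import structures.
Require Import Defs.
From mathcomp Require Import all_boot all_order all_algebra all_field.
From mathcomp Require Import complex.
From mathcomp Require Import reals boolp trigo.

Set Implicit Arguments.
Unset Strict Implicit.
Unset Printing Implicit Defensive.

Import Order.TTheory GRing.Theory Num.Theory.
Local Open Scope ring_scope.

(** As an algebra H is the group algebra of Z/2 x D_m, where a generates Z/2
    and t = s_+ s_- is the rotation of order m in the dihedral group D_m.  Let
    g' denote the image of a group element g under the automorphism that fixes
    a and exchanges s_+ and s_-; it inverts t.  Then
      Delta g = g (x) e_0 g + g' (x) e_1 g    and    S g = e_0 g^-1 + e_1 g'^-1
    (comul_word, antipode_word): the comultiplication is that of the group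
    algebra, twisted by g -> g' on the second half.  These formulas are
    multiplicative in g, so they need checking on generators only, and they
    show that S is antimultiplicative (antipodeM).

    Only if.  A normal subgroup of Z/2 x D_m that is stable under g -> g'
    gives a Hopf ideal; for the subgroup generated by g this ideal is
    H (g - 1) (hopf_ideal_limg_amulr).  A Hopf ideal annihilates A as soon as
    it annihilates u and v (hopf_ideal_annihilates).  If delta = 1 then g = a
    fixes u and v; if d = gcd(i, m) then g = t^(m/d) fixes u and v, since t
    acts on them by lambda^i and lambda^-i.  So inner-faithfulness forces
    g = 1; but a <> 1 and t has order m, as representations show.

    If.  Let I be a Hopf ideal that annihilates A.  The linear functionals
    that vanish on I are closed under convolution (I is a coideal,
    conv_annihilates) and under translation (I is a two-sided ideal).  One of
    them is the coefficient phi(h) of u in h.u: with w = lambda^i,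
      phi(a^e t^k) = (-1)^e w^k,   phi(a^e t^k s_+) = 0.
    If f(ag) = -f(g) then the twisted comultiplication gives
    (h * f)(g) = h(g') f(g); if f(ag) = f(g) it gives (h * f)(g) = h(g) f(g)
    (conv_odd, conv_even).  The translate of phi by s_+ on both sides takes
    the value phi(g) at g', so its convolution with phi is psi(g) = phi(g)^2,
    and the convolution powers of psi are its pointwise powers.  As w is a
    primitive m-th root of unity and m is odd, w^2 is primitive too, and the
    sum of m successive powers of psi is m times the indicator of {1, a}.
    Convolving it with phi changes the sign at a, and averaging gives the
    indicator tau of 1 (tau_nf).  The coefficient of any group element in x
    is the value of a translate of tau at x, hence it vanishes for x in I:
    thus I = 0 (tau_reproduces, hopf_ideal_eq0). *)

(** * Bilinear maps on tensor products *)

Section TensorLift.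
Variables (K : fieldType) (U V : vectType K).

Lemma tens_linearl (v : V) : linear (fun u : U => tens u v).
Proof. by move=> c x y; rewrite tensDl tensZl. Qed.

Lemma tens_linearr (u : U) : linear (fun v : V => tens u v).
Proof. by move=> c x y; rewrite tensDr tensZr. Qed.

Lemma tens0r (u : U) : tens u (0 : V) = 0.
Proof. by rewrite -(scale0r 0) tensZr scale0r. Qed.

Lemma tliftD (W : lmodType K) (B : U -> V -> W) :
  {morph tlift B : s t / s + t}.
Proof. by move=> s t; rewrite -[s]scale1r tlift_linear !scale1r. Qed.

Lemma tlift0 (W : lmodType K) (B : U -> V -> W) : tlift B 0 = 0.
Proof. by apply: (addrI (tlift B 0)); rewrite -tliftD !addr0. Qed.

Lemma tliftZ (W : lmodType K) (B : U -> V -> W) c t :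
  tlift B (c *: t) = c *: tlift B t.
Proof. by rewrite -[c *: t]addr0 tlift_linear tlift0 addr0. Qed.

Lemma tlift_sum (W : lmodType K) (B : U -> V -> W) n (F : 'I_n -> tensor U V) :
  tlift B (\sum_(j < n) F j) = \sum_(j < n) tlift B (F j).
Proof. exact: (big_morph _ (@tliftD _ B) (@tlift0 _ B)). Qed.

(** The subspace X (x) Y is spanned by pure tensors, on which the lift of B
    takes the values of B; P stands for membership in any linear subspace, so that
    both vanishing and membership statements are instances. *)
Lemma tlift_tensv (W : lmodType K) (B : U -> V -> W) (P : W -> Prop)
    (X : {vspace U}) (Y : {vspace V}) t :
    (forall x, linear (B x)) -> (forall y, linear (B^~ y)) ->
    P 0 -> (forall c x y, P x -> P y -> P (c *: x + y)) ->
    (forall x y, x \in X -> y \in Y -> P (B x y)) ->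
  t \in tensv X Y -> P (tlift B t).
Proof.
move=> Br Bl P0 Pl PB; rewrite /tensv.
set s := [seq _ | _ <- _, _ <- _]; rewrite -[s]in_tupleE => /coord_span ->.
rewrite tlift_sum; elim/big_ind: _ => // [x y Px Py|j _].
  by rewrite -[x]scale1r; apply: Pl.
rewrite tliftZ -[_ *: _]addr0; apply: Pl => //.
have /allpairsP[[x y] /= [Xx Yy ->]] : s`_j \in s by rewrite mem_nth.
by rewrite tliftE //; apply: PB; apply: vbasis_mem.
Qed.

End TensorLift.

Section TensorProduct.
Variables (K : fieldType) (A B : falgType K).
Implicit Types s t : tensor A B.

Lemma mulr_linear (x : A) : linear (fun y : A => x * y).
Proof. by move=> c y z; rewrite mulrDr -scalerAr. Qed.

Lemma mull_linear (y : A) : linear (fun x : A => x * y).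
Proof. by move=> c x z; rewrite mulrDl -scalerAl. Qed.

Lemma tmulDl t : {morph (fun s => tmul s t) : s s' / s + s'}.
Proof. by move=> s s'; rewrite /tmul tliftD. Qed.

Lemma tmulDr s : {morph tmul s : t t' / t + t'}.
Proof.
pose F t x y : tensor A B := tlift (fun x' y' => tens (x * x') (y * y')) t.
move=> t t'; rewrite -[LHS]/(tlift (F (t + t')) s).
rewrite -[RHS]/(tlift (F t) s + tlift (F t') s) /tlift -big_split.
apply: eq_bigr => p _; rewrite -big_split; apply: eq_bigr => q _ /=.
by rewrite -scalerDr; congr (_ *: _); apply: tliftD.
Qed.

Lemma tmul_tens (x x' : A) (y y' : B) :
  tmul (tens x y) (tens x' y') = tens (x * x') (y * y').
Proof.
have El u v u' v' :
    tlift (fun x' y' => tens (u * x') (v * y')) (tens u' v')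
    = tens (u * u') (v * v') :> tensor A B.
  rewrite (tliftE (B := fun x' y' => tens (u * x') (v * y'))) //.
    by move=> z c p q; rewrite mulrDr -scalerAr tens_linearr.
  by move=> z c p q; rewrite mulrDr -scalerAr tens_linearl.
rewrite /tmul tliftE ?El //.
  by move=> z c p q; rewrite !El mulrDl -scalerAl tens_linearr.
by move=> z c p q; rewrite !El mulrDl -scalerAl tens_linearl.
Qed.

Lemma tmul_tensv (X : {vspace A}) (Y : {vspace B}) s t :
    (forall x z, x \in X -> z * x \in X) ->
    (forall y z, y \in Y -> z * y \in Y) ->
  t \in tensv X Y -> tmul s t \in tensv X Y.
Proof.
move=> XI YI tXY; rewrite /tmul {1}/tlift.
apply: memv_suml => p _; apply: memv_suml => q _; apply: memvZ.
apply: (tlift_tensv (P := fun w => w \in tensv X Y) _ _ _ _ _ tXY) => //.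
- by move=> z c u v; rewrite mulrDr -scalerAr tens_linearr.
- by move=> z c u v; rewrite mulrDr -scalerAr tens_linearl.
- exact: mem0v.
- by move=> c x y Px Py; apply: memvD => //; apply: memvZ.
- by move=> x y Xx Yy; apply: memv_tens; [apply: XI | apply: YI].
Qed.

End TensorProduct.

(** * Hopf ideals and functionals vanishing on them *)

Section ModuleAlgebra.
Variables (K : fieldType) (H : hopfAlgebra K) (A : algType K).
Variable act : H -> A -> A.
Hypothesis MA : module_algebra act.

Lemma act_zero h : act h 0 = 0.
Proof.
have [actr _ _ _ _ _] := MA; have := actr h (-1) 0 0.
by rewrite scaler0 addr0 scaleN1r addNr.
Qed.

Lemma act_scale h k x : act h (k *: x) = k *: act h x.
Proof.
have [actr _ _ _ _ _] := MA.
by have := actr h k x 0; rewrite act_zero !addr0.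
Qed.

Lemma act_eigenX h x k n : act h x = k *: x -> act (h ^+ n) x = k ^+ n *: x.
Proof.
have [_ _ act1 actM _ _] := MA => hx.
elim: n => [|n IHn]; first by rewrite act1 scale1r.
by rewrite exprSr actM hx act_scale IHn scalerA -exprS.
Qed.

End ModuleAlgebra.

Section HopfIdeals.
Variables (K : fieldType) (H : hopfAlgebra K).
Implicit Types (I : {vspace H}) (f g : 'Hom(H, K^o)).

(** Both I (x) H and H (x) I are killed by a bilinear map that vanishes as soon
    as one of its arguments lies in I. *)
Lemma tlift_coideal (W : lmodType K) (B : H -> H -> W) I x :
    hopf_ideal I ->
    (forall x, linear (B x)) -> (forall y, linear (B^~ y)) ->
    (forall x y, x \in I -> B x y = 0) -> (forall x y, y \in I -> B x y = 0) ->
  x \in I -> tlift B (comul x) = 0.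
Proof.
move=> [_ dI _ _] Br Bl BI0 B0I /dI /memv_addP[s sI [t tI ->]].
have P0 c (y z : W) : y = 0 -> z = 0 -> c *: y + z = 0.
  by move=> -> ->; rewrite scaler0 addr0.
rewrite tliftD (tlift_tensv (P := eq^~ 0) Br Bl _ _ _ sI) //; last first.
  by move=> u v uI _; apply: BI0.
rewrite (tlift_tensv (P := eq^~ 0) Br Bl _ _ _ tI) ?addr0 //.
by move=> u v _ vI; apply: B0I.
Qed.

(** The elements of A that I annihilates form a subalgebra: they contain 1
    because the counit vanishes on I, and are closed under products because I
    is a coideal. *)
Lemma hopf_ideal_annihilates (A : algType K) (act : H -> A -> A) I (X : seq A) :
    module_algebra act -> hopf_ideal I -> generates X ->
    (forall h x, h \in I -> x \in X -> act h x = 0) ->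
  forall h x, h \in I -> act h x = 0.
Proof.
move=> MA HI gX IX0 h x hI.
have [actr actl _ _ actM act1] := MA; have [_ _ eI _] := HI.
pose S := [pred y | `[< forall k, k \in I -> act k y = 0 >]].
suff /asboolP/(_ h hI) : x \in S by [].
apply: gX => [|y Xy]; last by apply/asboolP=> k kI; apply: IX0.
split=> [|c y z /asboolP Sy /asboolP Sz|y z /asboolP Sy /asboolP Sz].
- by apply/asboolP=> k kI; rewrite act1 eI // scale0r.
- by apply/asboolP=> k kI; rewrite actr Sy // Sz // scaler0 addr0.
apply/asboolP=> k kI; rewrite actM.
apply: (tlift_coideal HI) => // [u|v|u v uI|u v vI].
- by move=> c p q; rewrite actl mulrDr -scalerAr.
- by move=> c p q; rewrite actl mulrDl -scalerAl.
- by rewrite Sy // mul0r.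
- by rewrite Sz // mulr0.
Qed.

(** The product of the algebra dual to the coalgebra H, first as a bare function
    so that its linearity can be registered. *)
Definition conv_fun (f g : 'Hom(H, K^o)) (x : H) : K^o :=
  tlift (fun y z => f y * g z) (comul x).

Lemma conv_fun_linear f g : linear (conv_fun f g).
Proof. by move=> c x y; rewrite /conv_fun linearP tlift_linear. Qed.

HB.instance Definition _ f g :=
  GRing.isLinear.Build K H K^o *:%R (conv_fun f g) (@conv_fun_linear f g).

Definition conv f g : 'Hom(H, K^o) := linfun (conv_fun f g).

Lemma bilin_linearr f g x : linear (fun y : H => f x * g y : K^o).
Proof. by move=> c y z; rewrite (linearP g) mulrDr -scalerAr. Qed.

Lemma bilin_linearl f g y : linear (fun x : H => f x * g y : K^o).
Proof. by move=> c x z; rewrite (linearP f) mulrDl -scalerAl. Qed.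

Lemma conv_annihilates f g I : hopf_ideal I ->
  (I <= lker f)%VS -> (I <= lker g)%VS -> (I <= lker (conv f g))%VS.
Proof.
move=> HI /subvP fI /subvP gI; apply/subvP=> x xI.
rewrite memv_ker lfunE; apply/eqP/(tlift_coideal HI) => // [y|z|y z yI|y z zI].
- exact: bilin_linearr.
- exact: bilin_linearl.
- by move: (fI _ yI); rewrite memv_ker => /eqP ->; rewrite mul0r.
- by move: (gI _ zI); rewrite memv_ker => /eqP ->; rewrite mulr0.
Qed.

End HopfIdeals.

(** * The group of words in the generators, and the structure maps on it *)

Section A4m.
Variables (K : fieldType) (m : nat) (H : hopfAlgebra K) (a sp sm : H).
Hypotheses (two_neq0 : 2%:R != 0 :> K) (m_gt0 : (0 < m)%N).
Hypothesis HA : is_A4m m a sp sm.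

(** The group generated by a, s_+ and s_-, together with the graph of its
    automorphism that exchanges s_+ and s_-: carrying the image g' along with g
    makes it available without constructing the automorphism. *)
Inductive word : H -> H -> Prop :=
| word_one : word 1 1
| word_a g g' of word g g' : word (g * a) (g' * a)
| word_sp g g' of word g g' : word (g * sp) (g' * sm)
| word_sm g g' of word g g' : word (g * sm) (g' * sp).

Lemma word_gens : [/\ word a a, word sp sm & word sm sp].
Proof.
split; [have := word_a word_one | have := word_sp word_one
  | have := word_sm word_one]; by rewrite !mul1r.
Qed.

Lemma word_sym g g' : word g g' -> word g' g.
Proof.
elim=> *; [exact: word_one | exact: word_a | exact: word_sm | exact: word_sp].
Qed.

Lemma wordM g g' h h' : word g g' -> word h h' -> word (g * h) (g' * h').
Proof.
move=> wg; elim=> [|h1 h2 _|h1 h2 _|h1 h2 _]; rewrite ?mulr1 // !mulrA => w.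
- exact: word_a.
- exact: word_sp.
- exact: word_sm.
Qed.

Lemma wordX g g' n : word g g' -> word (g ^+ n) (g' ^+ n).
Proof.
move=> wg; elim: n => [|n IHn]; first exact: word_one.
by rewrite !exprS; apply: wordM.
Qed.

(** Words span H, because their span is closed under products: the subspaces Q
    below are translated first by a general element, then by a word. *)
Lemma word_linear_ind (P : H -> Prop) :
    (forall c x y, P x -> P y -> P (c *: x + y)) ->
    (forall g g', word g g' -> P g) ->
  forall x, P x.
Proof.
move=> Pl Pw x.
pose lin (Q : H -> Prop) :=
  Q 0 /\ forall c x y, Q x -> Q y -> Q (c *: x + y).
pose S := [pred y | `[< forall Q : H -> Prop, lin Q ->
  (forall g g', word g g' -> Q g) -> Q y >]].
have P0 : P 0.
  have P1 := Pw _ _ word_one.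
  by rewrite -[0](addNr 1) -scaleN1r; apply: Pl.
suff /asboolP : x \in S by apply.
have SW g g' : word g g' -> g \in S.
  by move=> wg; apply/asboolP=> Q _; apply; exact: wg.
apply: (A4m_gen HA) => [|y]; last first.
  have [wa wp wm] := word_gens.
  rewrite !inE => /or3P[] /eqP ->.
  - exact: SW wa.
  - exact: SW wp.
  - exact: SW wm.
split=> [|c y z /asboolP Sy /asboolP Sz|y z /asboolP Sy /asboolP Sz].
- exact: SW word_one.
- by apply/asboolP=> Q lQ wQ; apply: (proj2 lQ); [apply: Sy | apply: Sz].
apply/asboolP=> Q lQ wQ; have [Q0 Ql] := lQ.
apply: (Sy (fun y => Q (y * z))) => [|g g' wg].
  split=> [|c p q Qp Qq]; first by rewrite mul0r.
  by rewrite mulrDl -scalerAl; apply: Ql.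
apply: (Sz (fun z => Q (g * z))) => [|h h' wh].
  split=> [|c p q Qp Qq]; first by rewrite mulr0.
  by rewrite mulrDr -scalerAr; apply: Ql.
exact: wQ (wordM wg wh).
Qed.

Lemma A4m_inv : [/\ a * a = 1, sp * sp = 1 & sm * sm = 1].
Proof. by case: (A4m_rel HA); rewrite !expr2. Qed.

Lemma a_central x : GRing.comm a x.
Proof.
have [aap aam _ _ _ _] := A4m_rel HA.
elim/word_linear_ind: x => [c x y cx cy|g g' wg].
  by apply: commrD => //; rewrite /GRing.comm -scalerAr -scalerAl cx.
by elim: wg => *; [exact: commr1 | exact: commrM .. ].
Qed.

Lemma e0_central x : GRing.comm (e0 a) x.
Proof.
rewrite /e0 /GRing.comm -scalerAl -scalerAr mulrDl mulrDr mul1r mulr1.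
by rewrite a_central.
Qed.

Lemma e1_central x : GRing.comm (e1 a) x.
Proof.
rewrite /e1 /GRing.comm -scalerAl -scalerAr mulrBl mulrBr mul1r mulr1.
by rewrite a_central.
Qed.

Lemma e0_mulrACA x y z : x * y * (e0 a * z) = x * e0 a * (y * z).
Proof. by rewrite !mulrA -(mulrA x) -e0_central mulrA. Qed.

Lemma e1_mulrACA x y z : x * y * (e1 a * z) = x * e1 a * (y * z).
Proof. by rewrite !mulrA -(mulrA x) -e1_central mulrA. Qed.

Lemma half_add_half : 2%:R^-1 + 2%:R^-1 = 1 :> K.
Proof. by rewrite -mulr2n -[LHS]mulr_natr mulVf. Qed.

Lemma e0De1 : e0 a + e1 a = 1.
Proof.
rewrite -scalerDr addrACA subrr addr0 scalerDr -scalerDl half_add_half.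
by rewrite scale1r.
Qed.

Lemma a_e0 : a * e0 a = e0 a.
Proof.
by have [aa _ _] := A4m_inv; rewrite -scalerAr mulrDr mulr1 aa addrC.
Qed.

Lemma a_e1 : a * e1 a = - e1 a.
Proof.
have [aa _ _] := A4m_inv.
by rewrite -scalerAr mulrBr mulr1 aa -scalerN opprB.
Qed.

Lemma e0_idem : e0 a * e0 a = e0 a.
Proof.
rewrite {1}/e0 -scalerAl mulrDl mul1r a_e0 scalerDr -scalerDl half_add_half.
by rewrite scale1r.
Qed.

Lemma e1_idem : e1 a * e1 a = e1 a.
Proof.
rewrite {1}/e1 -scalerAl mulrBl mul1r a_e1 opprK scalerDr -scalerDl.
by rewrite half_add_half scale1r.
Qed.

Lemma mul_e0_e1 : e0 a * e1 a = 0.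
Proof. by rewrite {1}/e0 -scalerAl mulrDl mul1r a_e1 subrr scaler0. Qed.

Lemma mul_e1_e0 : e1 a * e0 a = 0.
Proof. by rewrite {1}/e1 -scalerAl mulrBl mul1r a_e0 subrr scaler0. Qed.

(** The formula holds for the generators and is multiplicative, since e_0 and
    e_1 are orthogonal central idempotents. *)
Lemma comul_word g g' : word g g' ->
  comul g = tens g (e0 a * g) + tens g' (e1 a * g).
Proof.
pose D g g' := comul g = tens g (e0 a * g) + tens g' (e1 a * g).
have DM x x' y y' : D x x' -> D y y' -> D (x * y) (x' * y').
  rewrite /D comulM => -> ->; rewrite tmulDl !tmulDr !tmul_tens.
  rewrite !e0_mulrACA !e1_mulrACA e0_idem e1_idem mul_e0_e1 mul_e1_e0.
  by rewrite !mul0r !tens0r addr0 add0r.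
have De0e1 x y : tens x (e0 a * y) + tens x (e1 a * y) = tens x y.
  by rewrite -tensDr -mulrDl e0De1 mul1r.
have Da : D a a by rewrite /D De0e1; case: (A4m_a_grouplike HA).
elim=> [|h h' _ IH|h h' _ IH|h h' _ IH].
- by rewrite De0e1 comul1.
- exact: DM.
- by apply: DM => //; exact: (A4m_comul_sp HA).
- by apply: DM => //; exact: (A4m_comul_sm HA).
Qed.

Lemma counit_word g g' : word g g' -> counit g = 1.
Proof.
have [_ ea] := A4m_a_grouplike HA.
have eM x y : counit x = 1 -> counit y = 1 -> counit (x * y) = 1 :> K^o.
  move=> ex ey; rewrite rmorphM; exact: etrans (congr2 *%R ex ey) (mulr1 _).
elim=> [|h h' _ IH|h h' _ IH|h h' _ IH]; first exact: rmorph1; apply: eM => //.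
- exact: (A4m_counit_sp HA).
- exact: (A4m_counit_sm HA).
Qed.

Lemma word_inv g g' : word g g' ->
  exists h h', g * h = 1 /\ g' * h' = 1.
Proof.
have [aa pp mm] := A4m_inv.
have ii (x y z : H) : y * y = 1 -> x * z = 1 -> x * y * (y * z) = 1.
  by move=> yy; rewrite mulrA -(mulrA x) yy mulr1.
elim=> [|g1 g2 _ [h [h' [e e']]]|g1 g2 _ [h [h' [e e']]]
  |g1 g2 _ [h [h' [e e']]]].
- by exists 1, 1; rewrite !mulr1.
- by exists (a * h), (a * h'); split; exact: ii.
- by exists (sp * h), (sm * h'); split; exact: ii.
- by exists (sm * h), (sp * h'); split; exact: ii.
Qed.

(** The antipode axiom at g and at g' gives two equations in S g and S g',
    which the idempotents e_0 and e_1 decouple. *)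
Lemma antipode_word g g' h h' : word g g' -> g * h = 1 -> g' * h' = 1 ->
  antipode g = e0 a * h + e1 a * h'.
Proof.
have anti x x' y : word x x' -> x * y = 1 ->
    antipode x * e0 a + antipode x' * e1 a = y.
  move=> wx xy; have := antipodel x.
  rewrite (comul_word wx) (counit_word wx) scale1r tliftD.
  have Bl z : linear (fun x : H => antipode x * z).
    by move=> c p q; rewrite linearP mulrDl -scalerAl.
  have Br z : linear (fun y : H => antipode z * y) by exact: mulr_linear.
  rewrite !tliftE // => /(congr1 (fun z => z * y)).
  by rewrite mul1r mulrDl -!mulrA xy !mulr1.
move=> wg gh gh'; have E0 := anti _ _ _ wg gh.
have E1 := anti _ _ _ (word_sym wg) gh'.
rewrite -[antipode g]mulr1 -e0De1 mulrDr -E0 -E1 [e0 a * _]e0_central.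
rewrite [e1 a * _]e1_central !mulrDl -!mulrA e0_idem e1_idem.
by rewrite mul_e0_e1 mul_e1_e0 !mulr0 addr0 add0r.
Qed.

Lemma antipodeM (x y : H) : antipode (x * y) = antipode y * antipode x.
Proof.
elim/word_linear_ind: x => [c x z IHx IHz|g g' wg].
  have -> : (c *: x + z) * y = c *: (x * y) + z * y by exact: mull_linear.
  rewrite linearP IHx IHz linearP.
  by apply/esym; exact: mulr_linear.
elim/word_linear_ind: y => [c x z IHx IHz|h h' wh].
  have -> : g * (c *: x + z) = c *: (g * x) + g * z by exact: mulr_linear.
  rewrite linearP IHx IHz linearP.
  by apply/esym; exact: mull_linear.
have [i [i' [gi gi']]] := word_inv wg.
have [j [j' [hj hj']]] := word_inv wh.
have ghji : g * h * (j * i) = 1 by rewrite mulrA -(mulrA g) hj mulr1.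
have ghji' : g' * h' * (j' * i') = 1 by rewrite mulrA -(mulrA g') hj' mulr1.
rewrite (antipode_word (wordM wg wh) ghji ghji').
rewrite (antipode_word wg gi gi') (antipode_word wh hj hj').
rewrite mulrDl !mulrDr !e0_mulrACA !e1_mulrACA.
by rewrite e0_idem e1_idem mul_e0_e1 mul_e1_e0 !mul0r addr0 add0r.
Qed.

(** The ideal generated by g - 1 when the subgroup generated by g is normal and
    stable under the automorphism g -> g'; both conditions are expressed by
    membership in the left ideal H (g - 1). *)
Lemma hopf_ideal_limg_amulr g g' :
    word g g' -> g' - 1 \in limg (amulr (g - 1)) ->
    (forall x, x \in [:: a; sp; sm] -> (g - 1) * x \in limg (amulr (g - 1))) ->
  hopf_ideal (limg (amulr (g - 1))).
Proof.
set I := limg _ => wg g'I gensI.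
have IP x : reflect (exists h, x = h * (g - 1)) (x \in I).
  apply: (iffP memv_imgP) => [[h _ ->]|[h ->]]; exists h; rewrite ?memvf //.
    by rewrite lfunE.
  by rewrite lfunE.
have gI : g - 1 \in I by apply/IP; exists 1; rewrite mul1r.
have lI x h : x \in I -> h * x \in I.
  by case/IP=> y ->; apply/IP; exists (h * y); rewrite mulrA.
have rI x h : x \in I -> x * h \in I.
  pose S := [pred h | `[< forall x, x \in I -> x * h \in I >]].
  suff /asboolP/(_ x) : h \in S by [].
  apply: (A4m_gen HA) => [|y /gensI gyI].
    split=> [|c y z /asboolP Sy /asboolP Sz|y z /asboolP Sy /asboolP Sz].
    - by apply/asboolP=> y yI; rewrite mulr1.
    - apply/asboolP=> p pI; rewrite mulrDr -scalerAr.
      by apply: memvD; [apply: memvZ; apply: Sy | apply: Sz].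
    - by apply/asboolP=> p pI; rewrite mulrA; apply/Sz/Sy.
  by apply/asboolP=> _ /IP[z ->]; rewrite -mulrA; apply: lI.
have lJ s t : t \in (tensv I fullv + tensv fullv I)%VS ->
    tmul s t \in (tensv I fullv + tensv fullv I)%VS.
  case/memv_addP=> t1 t1I [t2 t2I ->]; rewrite tmulDr.
  by apply: memv_add; apply: tmul_tensv => // *; rewrite ?memvf //; apply: lI.
split=> [x h xI|_ /IP[h ->]|_ /IP[h ->]|_ /IP[h ->]].
- by split; [apply: lI | apply: rI].
- rewrite comulM; apply: lJ; rewrite linearB /= comul1 (comul_word wg).
  (* g - 1 is skew-primitive up to the twist, since e0 g + e1 g = g. *)
  have -> : tens g (e0 a * g) + tens g' (e1 a * g) - tens1 H H =
      tens (g - 1) (e0 a * g) + tens (g' - 1) (e1 a * g) + tens 1 (g - 1).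
    have tensB x y : tens (x - 1) y = tens x y - tens 1 y :> tensor H H.
      by rewrite -scaleN1r tensDl tensZl scaleN1r.
    rewrite !tensB -[-1]scaleN1r tensDr tensZr scaleN1r.
    rewrite -[in tens 1 g](mul1r g) -e0De1 mulrDl tensDr e0De1.
    by rewrite [X in _ = X + _]addrACA -opprD addrA subrK.
  apply: memv_add; last by apply: memv_tens; rewrite ?memvf.
  by apply: memvD; apply: memv_tens; rewrite ?memvf.
- have eg : counit (g - 1) = 0 :> K^o.
    rewrite rmorphB; apply/eqP; rewrite subr_eq0; apply/eqP.
    exact: etrans (counit_word wg) (esym (rmorph1 _)).
  by rewrite rmorphM; exact: etrans (congr2 *%R erefl eg) (mulr0 _).
have [h1 [h1' [gh gh']]] := word_inv wg.
rewrite antipodeM linearB /= (antipode_word wg gh gh'); apply/rI.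
have -> : antipode 1 = 1 :> H.
  by rewrite (antipode_word word_one (mul1r 1) (mul1r 1)) !mulr1 e0De1.
have -> : e0 a * h1 + e1 a * h1' - 1 =
    - (e0 a * ((g - 1) * h1) + e1 a * ((g' - 1) * h1')).
  rewrite !mulrBl gh gh' !mul1r !mulrBr !mulr1 addrACA e0De1.
  by rewrite -opprD opprB.
by rewrite memvN; apply: memvD; apply/lI/rI.
Qed.

End A4m.

(** * Normal forms of words *)

Lemma intertwineX (B : nzRingType) (x y z : B) k :
  z * x = y * z -> z * x ^+ k = y ^+ k * z.
Proof.
move=> zx; elim: k => [|k IHk]; first by rewrite mul1r mulr1.
by rewrite exprSr mulrA IHk exprSr -!mulrA zx.
Qed.

Section Normal.
Variables (K : fieldType) (m : nat) (H : hopfAlgebra K) (a sp sm : H).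
Hypotheses (two_neq0 : 2%:R != 0 :> K) (m_gt0 : (0 < m)%N).
Hypothesis HA : is_A4m m a sp sm.

(** The exponents are unbounded, so that a product of words in this form need
    not be reduced modulo the orders of a and of s_+ s_-. *)
Definition normal_form e k (s : bool) : H := a ^+ e * (sp * sm) ^+ k * sp ^+ s.
Definition bar_normal_form e k (s : bool) : H :=
  a ^+ e * (sm * sp) ^+ k * sm ^+ s.
Notation nf := normal_form.
Notation nf' := bar_normal_form.

Lemma rotMinv : (sp * sm) * (sm * sp) = 1.
Proof.
by have [_ pp mm] := A4m_inv HA; rewrite mulrA -(mulrA sp) mm mulr1.
Qed.

Lemma rotV : (sp * sm) ^+ m.-1 = sm * sp.
Proof.
have tm := A4m_spm (A4m_rel HA).
by rewrite -[LHS]mulr1 -rotMinv mulrA -exprSr prednK // tm mul1r.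
Qed.

Lemma rotX_mod k : (sp * sm) ^+ (k %% m) = (sp * sm) ^+ k.
Proof. exact: expr_mod (A4m_spm (A4m_rel HA)). Qed.

Lemma aX_mod e : a ^+ odd e = a ^+ e.
Proof. by rewrite -modn2; apply: expr_mod; exact: A4m_a2 (A4m_rel HA). Qed.

Lemma word_nf e k s : word a sp sm (nf e k s) (nf' e k s).
Proof.
have [wa wp wm] := word_gens a sp sm.
apply: wordM; last exact: wordX.
by apply: wordM; apply: wordX => //; apply: wordM.
Qed.

(** Right multiplication by a generator preserves the normal forms, because
    t s_- = s_+ and hence t^k s_- = t^(k - 1) s_+. *)
Lemma nfP g g' : word a sp sm g g' ->
  exists e k s, g = nf e k s /\ g' = nf' e k s.
Proof.
have [aa pp mm] := A4m_inv HA.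
have Enf e k s : nf e k s = a ^+ e * (sp * sm) ^+ k * sp ^+ s by [].
have Enf' e k s : nf' e k s = a ^+ e * (sm * sp) ^+ k * sm ^+ s by [].
have Ca x n y : a ^+ n * x * y * a = a ^+ n.+1 * x * y.
  by rewrite exprSr -!mulrA; congr (_ * _); rewrite (a_central HA) mulrA.
have tp : sp * sm * sm = sp by rewrite -mulrA mm mulr1.
have tm : sm * sp * sp = sm by rewrite -mulrA pp mulr1.
(* The exponent k + m.-1 stands for k - 1, as t has order dividing m. *)
have sub1 (p q : H) n k : (p * q) ^+ m = 1 -> p * q * q = p ->
    a ^+ n * (p * q) ^+ k * q = a ^+ n * (p * q) ^+ (k + m.-1) * p.
  move=> pqm pqq; rewrite -[LHS]mulrA -[RHS]mulrA; congr (_ * _).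
  rewrite -[X in _ = _ * X]pqq [RHS]mulrA -exprSr -addnS prednK //.
  by rewrite exprD pqm mulr1.
have spm := A4m_spm (A4m_rel HA).
have smm : (sm * sp) ^+ m = 1.
  by rewrite -rotV -exprM mulnC exprM spm expr1n.
elim=> [|h h' _ [e [k [s [-> ->]]]]|h h' _ [e [k [s [-> ->]]]]
  |h h' _ [e [k [s [-> ->]]]]].
- by exists 0%N, 0%N, false; rewrite Enf Enf' !mulr1.
- by exists e.+1, k, s; rewrite !Enf !Enf' !Ca.
- case: s.
    by exists e, k, false; rewrite !Enf !Enf' /= !expr1 -!mulrA pp mm.
  by exists e, k, true; rewrite !Enf !Enf' /= !expr0 !expr1 !mulr1.
case: s; last first.
  exists e, (k + m.-1)%N, true.
  by rewrite !Enf !Enf' /= !expr0 !expr1 !mulr1 !sub1.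
exists e, k.+1, false.
by rewrite !Enf !Enf' /= !expr0 !expr1 !mulr1 !exprSr !mulrA.
Qed.

(** Here h vanishes at e_0 g and agrees with its value at g on e_1 g, so only
    the term g' (x) e_1 g of the comultiplication contributes. *)
Lemma conv_odd (f h : 'Hom(H, K^o)) g g' : word a sp sm g g' ->
  h (a * g) = - h g -> conv f h g = f g' * h g :> K.
Proof.
move=> wg hag; rewrite lfunE /= /conv_fun (comul_word two_neq0 HA wg) tliftD.
rewrite !tliftE; try exact: bilin_linearl; try exact: bilin_linearr.
rewrite /e0 /e1 -!scalerAl !linearZ mulrDl mulrBl !mul1r linearD linearB /= hag.
rewrite opprK subrr scaler0 mulr0 add0r scalerDr -scalerDl half_add_half //.
by rewrite scale1r.
Qed.

(** Here h vanishes at e_1 g, and only the untwisted term g (x) e_0 g of the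
    comultiplication contributes. *)
Lemma conv_even (f h : 'Hom(H, K^o)) g g' : word a sp sm g g' ->
  h (a * g) = h g -> conv f h g = f g * h g :> K.
Proof.
move=> wg hag; rewrite lfunE /= /conv_fun (comul_word two_neq0 HA wg) tliftD.
rewrite !tliftE; try exact: bilin_linearl; try exact: bilin_linearr.
rewrite /e0 /e1 -!scalerAl !linearZ mulrDl mulrBl !mul1r linearD linearB /= hag.
rewrite subrr scaler0 mulr0 addr0 scalerDr -scalerDl half_add_half //.
by rewrite scale1r.
Qed.

End Normal.

(** * Recovering coefficients from one matrix coefficient *)

Section Separation.
Variables (K : fieldType) (m : nat) (H : hopfAlgebra K) (a sp sm : H).
Hypotheses (two_neq0 : 2%:R != 0 :> K) (m_gt0 : (0 < m)%N).
Hypothesis HA : is_A4m m a sp sm.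
Notation nf := (normal_form a sp sm).
Notation nf' := (bar_normal_form a sp sm).
Notation word := (word a sp sm).

Lemma mul_a_nf e k s : a * nf e k s = nf e.+1 k s.
Proof. by rewrite /normal_form exprS !mulrA. Qed.

Lemma nf'_rotation e k : nf' e k false = nf e (m.-1 * k) false.
Proof.
by rewrite /bar_normal_form /normal_form !expr0 exprM (rotV m_gt0 HA).
Qed.

Lemma sp_rotX k : sp * (sm * sp) ^+ k = (sp * sm) ^+ k * sp.
Proof. by apply: intertwineX; rewrite mulrA. Qed.

Lemma aX_central x e : x * a ^+ e = a ^+ e * x.
Proof. exact: commrX (commr_sym (a_central HA x)). Qed.

(** A geometric sum in w^(2k), which is 1 exactly when m divides k because m is
    odd. *)
Lemma sum_expr_root (w : K) k : m.-primitive_root w -> odd m ->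
  \sum_(n < m) w ^+ k ^+ (n.*2.+2) = if (m %| k)%N then m%:R else 0.
Proof.
move=> w_prim m_odd; set y := w ^+ (k * 2).
have -> : \sum_(n < m) w ^+ k ^+ (n.*2.+2) = y * \sum_(n < m) y ^+ n.
  rewrite mulr_sumr; apply: eq_bigr => n _.
  by rewrite -exprS -!exprM -mulnA mul2n doubleS.
have -> : (m %| k)%N = (y == 1).
  by rewrite /y -(prim_order_dvd w_prim) Gauss_dvdl // coprimen2.
have [->|y1] := eqVneq y 1.
  rewrite mul1r (eq_bigr (fun=> 1)) ?sumr_const ?card_ord // => n _.
  by rewrite expr1n.
have /eqP := subrX1 y m.
rewrite /y -exprM mulnC exprM (prim_expr_order w_prim) expr1n -/y subrr.
by rewrite eq_sym mulf_eq0 subr_eq0 (negPf y1) => /eqP ->; rewrite mulr0.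
Qed.

Section Functional.
Variables (I : {vspace H}) (phi : 'Hom(H, K^o)) (w : K).
Hypotheses (m_odd : odd m) (w_prim : m.-primitive_root w).
Hypothesis (HI : hopf_ideal I).
Hypotheses (phiI : (I <= lker phi)%VS).
Hypothesis phi_nf :
  forall e k s, phi (nf e k s) = if s then 0 else (-1) ^+ e * w ^+ k.

Lemma phi_a g g' : word g g' -> phi (a * g) = - phi g.
Proof.
move=> /(nfP m_gt0 HA)[e [k [s [-> _]]]]; rewrite mul_a_nf !phi_nf.
by case: s; rewrite ?oppr0 // exprS mulN1r mulNr.
Qed.

Lemma lker_mul x y (h : 'Hom(H, K^o)) : (I <= lker h)%VS ->
  (I <= lker (h \o (amull x \o amulr y))%VF)%VS.
Proof.
move=> /subvP hI; apply/subvP=> z zI; have [II _ _ _] := HI.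
rewrite memv_ker !comp_lfunE !lfunE /= -memv_ker.
by apply: hI; apply: (II _ _ _).1; apply: (II _ _ _).2.
Qed.

Definition phi_refl : 'Hom(H, K^o) := (phi \o (amull sp \o amulr sp))%VF.

(** Conjugation by s_+ inverts t, as does g -> g', so g and s_+ g' s_+ agree on
    rotations, while phi vanishes on all reflections. *)
Lemma phi_refl_word g g' : word g g' -> phi_refl g' = phi g.
Proof.
have [aa pp mm] := A4m_inv HA.
move=> /(nfP m_gt0 HA)[e [k [s [-> ->]]]].
rewrite /phi_refl !comp_lfunE !lfunE /= /bar_normal_form !mulrA aX_central.
rewrite -(mulrA _ sp) sp_rotX.
case: s => /=.
  have -> : a ^+ e * ((sp * sm) ^+ k * sp) * sm ^+ 1 * sp = nf e k.+1 true.
    by rewrite /normal_form !expr1 exprSr -!mulrA.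
  by rewrite !phi_nf.
have -> : a ^+ e * ((sp * sm) ^+ k * sp) * sm ^+ 0 * sp = nf e k false.
  by rewrite /normal_form !expr0 !mulr1 -!mulrA pp mulr1.
by rewrite !phi_nf.
Qed.

Definition psi := conv phi_refl phi.

Lemma psi_word g g' : word g g' -> psi g = phi g ^+ 2.
Proof.
move=> wg; rewrite (conv_odd two_neq0 HA _ wg) ?(phi_a wg) //.
by rewrite (phi_refl_word wg).
Qed.

Definition psiX n := iter n (conv psi) psi.

Lemma psiX_word n g g' : word g g' -> psiX n g = phi g ^+ n.*2.+2.
Proof.
elim: n g g' => [|n IHn] g g' wg; first exact: psi_word wg.
have [wa _ _] := word_gens a sp sm.
rewrite /= (conv_even two_neq0 HA _ wg).
  by rewrite (psi_word wg) (IHn _ _ wg) -exprD.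
rewrite -/(psiX n) (IHn _ _ (wordM wa wg)) (IHn _ _ wg) (phi_a wg).
by rewrite exprNn -signr_odd /= odd_double expr0 mul1r.
Qed.

Lemma psiX_lker n : (I <= lker (psiX n))%VS.
Proof.
have psiI : (I <= lker psi)%VS.
  by apply: conv_annihilates => //; apply: lker_mul.
by elim: n => // n IHn; apply: conv_annihilates.
Qed.

(** On words, m times the indicator of the subgroup {1, a}. *)
Definition tau_a : 'Hom(H, K^o) := \sum_(n < m) psiX n.

Lemma tau_a_nf e k s :
  tau_a (nf e k s) = if ~~ s && (m %| k)%N then m%:R else 0.
Proof.
rewrite sum_lfunE.
rewrite (eq_bigr (fun n : 'I_m => phi (nf e k s) ^+ n.*2.+2)); last first.
  by move=> n _; rewrite (psiX_word _ (word_nf a sp sm e k s)).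
case: s; rewrite phi_nf /=.
  by rewrite big1 // => n _; rewrite expr0n.
rewrite -(sum_expr_root k w_prim m_odd); apply: eq_bigr => n _.
have even_sign (x : K) : ((-1) ^+ e * x) ^+ n.*2.+2 = x ^+ n.*2.+2.
  rewrite exprMn exprAC -[(-1) ^+ n.*2.+2]signr_odd /= odd_double.
  by rewrite expr0 expr1n mul1r.
exact: even_sign.
Qed.

(** On words, the indicator of 1: convolving tau_a with phi restores the sign
    of a, and averaging with tau_a itself eliminates a. *)
Definition tau : 'Hom(H, K^o) := (m * 2)%:R^-1 *: (tau_a + conv tau_a phi).

(** At a rotation g the convolution of tau_a with phi is tau_a(g') phi(g); the
    automorphism g -> g' preserves {1, a}, where phi is a sign. *)
Lemma tau_nf e k s : tau (nf e k s) = (~~ s && (m %| k)%N && ~~ odd e)%:R.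
Proof.
have wg := word_nf a sp sm e k s.
rewrite scale_lfunE add_lfunE (conv_odd two_neq0 HA _ wg) ?(phi_a wg) //.
rewrite tau_a_nf phi_nf; case: s wg => _ /=.
  by rewrite mulr0 addr0 scaler0.
rewrite nf'_rotation tau_a_nf /= Gauss_dvdr; last first.
  by rewrite coprime_sym coprimePn.
case: ifP => [mk|_]; last by rewrite mul0r addr0 scaler0.
have -> : w ^+ k = 1 by apply/eqP; rewrite -(prim_order_dvd w_prim).
rewrite mulr1 -signr_odd; case: (odd e).
  by rewrite expr1 mulrN1 subrr scaler0.
rewrite expr0 mulr1 -mulr2n -mulrnA.
rewrite /GRing.scale /= mulVf // natrM mulf_neq0 //.
exact: prim_root_natf_neq0 w_prim.
Qed.

Lemma tau_lker : (I <= lker tau)%VS.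
Proof.
have tI : (I <= lker tau_a)%VS.
  apply/subvP=> x xI; rewrite memv_ker sum_lfunE big1 // => n _.
  by apply/eqP; rewrite -memv_ker; apply: (subvP (psiX_lker n)).
have /subvP cI : (I <= lker (conv tau_a phi))%VS by apply: conv_annihilates.
apply/subvP=> x xI; move: (subvP tI _ xI) (cI _ xI).
rewrite !memv_ker scale_lfunE add_lfunE => /eqP -> /eqP ->.
by rewrite addr0 scaler0.
Qed.

Definition normal_form_inv e k (s : bool) : H :=
  sp ^+ s * (sm * sp) ^+ k * a ^+ e.

Lemma dvdn_add_pred_mul k k' : (m %| k + m.-1 * k')%N = (k == k' %[mod m]).
Proof.
rewrite /dvdn -[in LHS](mod0n m) -(eqn_modDr k') -addnA -mulSnr prednK //.
by rewrite add0n addnC mulnC modnMDl.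
Qed.

Lemma tau_nf_mul_inv e k s e' k' s' :
  tau (nf e k s * normal_form_inv e' k' s')
  = ((s == s') && (k == k' %[mod m]) && (odd e == odd e'))%:R.
Proof.
have [aa pp mm] := A4m_inv HA.
have -> : nf e k s * normal_form_inv e' k' s' =
    nf (e' + e) (k + (if s == s' then m.-1 * k' else k')%N) (s != s').
  rewrite /normal_form_inv mulrA aX_central /normal_form exprD -!mulrA.
  congr (_ * (_ * _)).
  rewrite !exprD; case: s s' => [] [] /=; rewrite ?(expr0, expr1, mul1r, mulr1).
  - by rewrite [sp * (sp * _)]mulrA pp mul1r exprM (rotV m_gt0 HA).
  - by rewrite sp_rotX !mulrA.
  - by rewrite sp_rotX !mulrA.
  - by rewrite exprM (rotV m_gt0 HA).
rewrite tau_nf negbK [(e' + e)%N]addnC; case: eqP => //= _.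
by rewrite dvdn_add_pred_mul oddD negb_add.
Qed.

(** The coefficient of a word g in x is tau (x g^-1). *)
Lemma tau_reproduces x : x =
  \sum_(p : bool * 'I_m * bool)
    tau (x * normal_form_inv p.1.1 p.1.2 p.2) *: nf p.1.1 p.1.2 p.2.
Proof.
elim/(word_linear_ind HA): x
  => [c x y IHx IHy|_ _ /(nfP m_gt0 HA)[e [k [s [-> _]]]]].
  rewrite {1}IHx {1}IHy scaler_sumr -big_split; apply: eq_bigr => p _ /=.
  have -> z : (c *: x + y) * z = c *: (x * z) + y * z by exact: mull_linear.
  by rewrite linearP scalerDl scalerA.
rewrite (bigD1 (odd e, Ordinal (ltn_pmod k m_gt0), s)) //=.
rewrite big1 ?addr0 => [|[[e' k'] s'] /= nep].
  rewrite tau_nf_mul_inv oddb modn_mod !eqxx scale1r /normal_form.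
  by rewrite (aX_mod HA) (rotX_mod HA).
rewrite tau_nf_mul_inv; case: (boolP (_ && _)) => [|_]; last by rewrite scale0r.
case/andP=> /andP[/eqP es /eqP ek] /eqP ee; case/eqP: nep.
rewrite es ee oddb; congr (_, _, _); apply: val_inj => /=.
by rewrite ek modn_small.
Qed.

Lemma hopf_ideal_eq0 : I = 0%VS.
Proof.
apply/eqP; rewrite -subv0; apply/subvP=> x xI; rewrite memv0.
have [II _ _ _] := HI.
rewrite [x]tau_reproduces big1 // => p _; apply/eqP; rewrite scaler_eq0.
rewrite -memv_ker (subvP tau_lker) //.
by have [] := II x (normal_form_inv p.1.1 p.1.2 p.2) xI.
Qed.

End Functional.
End Separation.

(** * Roots of unity *)

Section Roots.
Variable R : realType.

Lemma lambdaX m k :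
  lambda R m ^+ k =
    (cos (2 * pi / m%:R * k%:R) +i* sin (2 * pi / m%:R * k%:R))%C.
Proof.
elim: k => [|k IHk]; first by rewrite mulr0 cos0 sin0.
have -> x : x * k.+1%:R = x * k%:R + x :> R by rewrite -natr1 mulrDr mulr1.
rewrite exprSr IHk /lambda cosD sinD.
by apply/eqP; rewrite eq_complex /= [sin _ * cos _ + _]addrC !eqxx.
Qed.

Lemma lambda_primitive m : (0 < m)%N -> m.-primitive_root (lambda R m).
Proof.
move=> m_gt0; apply/andP; split=> //; apply/forallP=> k; rewrite unity_rootE.
have m0 : m%:R != 0 :> R by rewrite pnatr_eq0 -lt0n.
rewrite lambdaX; have [km|nkm] := eqVneq k.+1 m.
  have -> : 2 * pi = pi + pi :> R by rewrite mulr_natl mulr2n.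
  rewrite km divfK // cosD sinD cospi sinpi.
  by rewrite eq_complex /= !mulr0 !mul0r mulrNN mulr1 oppr0 !addr0 !eqxx.
rewrite eqbF_neg; apply/negP; rewrite eq_complex /= => /andP[+ _].
set x := _ * _ => cos1.
pose y : R := pi * (k.+1%:R / m%:R).
(* cos (2y) = 1 - 2 sin(y)^2, and sin y > 0 for 0 < y < pi. *)
have xy : x = y *+ 2.
  by rewrite -[RHS]mulr_natl /x /y [_%:R / _]mulrC !mulrA.
have ltkm : (k.+1 < m)%N by rewrite ltn_neqAle nkm ltn_ord.
have sy : 0 < sin y.
  apply: sin_gt0_pi; rewrite /y mulr_gt0 ?pi_gt0 ?divr_gt0 ?ltr0n //=.
  by rewrite gtr_pMr ?pi_gt0 // ltr_pdivrMr ?ltr0n // mul1r ltr_nat.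
move: cos1; rewrite xy cos_mulr2n cos2sin2 mulrnBl addrAC mulr2n addrK.
rewrite -subr_eq0 addrAC subrr add0r oppr_eq0 mulrn_eq0 /= expf_eq0 /=.
by rewrite gt_eqF.
Qed.

End Roots.

(** * Inner-faithfulness *)

Section Faithful.
Variables (K : fieldType) (m : nat) (H : hopfAlgebra K) (a sp sm : H).
Hypotheses (two_neq0 : 2%:R != 0 :> K) (m_gt0 : (0 < m)%N).
Hypothesis HA : is_A4m m a sp sm.
Notation nf := (normal_form a sp sm).
Notation word := (word a sp sm).

(** The Hopf ideal H (g - 1) annihilates the generators, hence the whole
    algebra. *)
Lemma inner_faithful_fixing_word (A : algType K) (act : H -> A -> A)
    (X : seq A) g g' :
    module_algebra act -> generates X -> word g g' ->
    g' - 1 \in limg (amulr (g - 1)) ->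
    (forall x, x \in [:: a; sp; sm] -> (g - 1) * x \in limg (amulr (g - 1))) ->
    (forall x, x \in X -> act g x = x) -> inner_faithful act ->
  g = 1.
Proof.
move=> MA gX wg g'I gI fixX.
have HI := hopf_ideal_limg_amulr two_neq0 HA wg g'I gI; move=> /(_ _ HI).
have [actr actl act1 actM _ _] := MA.
move=> I0; apply/eqP; rewrite -subr_eq0 -memv0 -I0.
  by apply/memv_imgP; exists 1; rewrite ?memvf // lfunE /= mul1r.
apply: (hopf_ideal_annihilates MA HI gX).
move=> _ x /memv_imgP[h _ ->] Xx; rewrite lfunE /= actM.
have -> : g - 1 = (-1) *: 1 + g by rewrite scaleN1r addrC.
by rewrite actl act1 fixX // scaleN1r addNr (act_zero MA).
Qed.

(** The one-dimensional representation with a acting by -1 and s_+, s_- acting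
    trivially separates a from 1. *)
Lemma A4m_a_neq1 : a <> 1.
Proof.
have r : A4m_relations m (-1 : K^o) 1 1.
  by split; rewrite ?mulr1 ?mul1r ?expr1n // sqrrN expr1n.
have [f [fa _ _]] := A4m_univ HA r.
move=> a1; move: fa; rewrite a1 rmorph1 => /eqP.
by rewrite eq_sym -subr_eq0 -opprD oppr_eq0 -mulr2n (negPf two_neq0).
Qed.

(** The two-dimensional representation in which s_+ s_- acts by the diagonal
    matrix with entries z and z^-1. *)
Lemma A4m_rot_order (z : K) n :
  m.-primitive_root z -> (sp * sm) ^+ n = 1 -> (m %| n)%N.
Proof.
move=> z_prim.
have z0 : z != 0 by rewrite (prim_root_eq0 z_prim) -lt0n.
pose P : 'M[K]_2 := \matrix_(i, j) (i != j)%:R.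
pose Q : 'M[K]_2 :=
  \matrix_(i, j) if i == j then 0 else if i == 0 then z^-1 else z.
pose D x y : 'M[K]_2 :=
  \matrix_(i, j) if i == j then if i == 0 then x else y else 0.
have D1 : D 1 1 = 1.
  by apply/matrixP=> [[[|[|//]] ?] [[|[|//]] ?]]; rewrite !mxE.
have DM x y x' y' : D x y * D x' y' = D (x * x') (y * y').
  apply/matrixP=> [[[|[|//]] ?] [[|[|//]] ?]];
  rewrite !mxE !big_ord_recl big_ord0 !mxE /=;
  by rewrite ?(mul0r, mulr0, addr0, add0r).
have PP : P * P = 1.
  apply/matrixP=> [[[|[|//]] ?] [[|[|//]] ?]];
  rewrite !mxE !big_ord_recl big_ord0 !mxE /=;
  by rewrite ?(mul0r, mulr0, addr0, add0r, mulr1).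
have QQ : Q * Q = 1.
  apply/matrixP=> [[[|[|//]] ?] [[|[|//]] ?]];
  rewrite !mxE !big_ord_recl big_ord0 !mxE /=;
  by rewrite ?(mul0r, mulr0, addr0, add0r, mulVf, mulfV).
have PQ : P * Q = D z z^-1.
  apply/matrixP=> [[[|[|//]] ?] [[|[|//]] ?]];
  rewrite !mxE !big_ord_recl big_ord0 !mxE /=;
  by rewrite ?(mul0r, mulr0, addr0, add0r, mul1r).
have DX k : (P * Q) ^+ k = D (z ^+ k) (z^-1 ^+ k).
  by elim: k => [|k IHk]; rewrite ?expr0 ?D1 // !exprS IHk PQ DM.
have r : A4m_relations m (1 : 'M[K]_2) P Q.
  split; rewrite ?mulr1 ?mul1r ?expr1n ?expr2 //.
  by rewrite DX exprVn (prim_expr_order z_prim) invr1 D1.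
have [f [_ fp fq]] := A4m_univ HA r.
move=> /(congr1 f); rewrite rmorphXn rmorphM /= fp fq rmorph1 DX -D1.
move=> /matrixP/(_ 0 0); rewrite !mxE /= => zn.
by rewrite (prim_order_dvd z_prim) zn.
Qed.

(** The functional fed to hopf_ideal_eq0 is the coefficient of u in h.u; it
    vanishes on I because I annihilates u. *)
Lemma annihilating_hopf_ideal_eq0 (A : algType K) (act : H -> A -> A)
    (V : {pred A}) (u v : A) (w : K) (I : {vspace H}) :
    odd m -> m.-primitive_root w ->
    module_algebra act -> ordered_basis2 V u v ->
    (forall h x, x \in V -> act h x \in V) ->
    act a u = - u -> act a v = - v -> act sp u = v -> act sp v = u ->
    act sm u = w *: v -> act sm v = w^-1 *: u ->
  hopf_ideal I -> (forall h x, h \in I -> act h x = 0) -> I = 0%VS.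
Proof.
move=> m_odd w_prim MA [uv0 uvP] actV au av pu pv mu mv HI I0.
have [actr actl act1 actM _ _] := MA.
have uV : u \in V by apply/uvP; exists 1, 0; rewrite scale1r scale0r addr0.
have /choice[c cP] h : exists x : K * K, act h u = x.1 *: u + x.2 *: v.
  by have /uvP[b [d ->]] := actV h u uV; exists (b, d).
have c_uniq h b d : act h u = b *: u + d *: v -> (c h).1 = b.
  rewrite cP => /eqP; rewrite -subr_eq0 opprD addrACA -!scalerBl => /eqP.
  by case/uv0 => /eqP; rewrite subr_eq0 => /eqP.
pose phi0 : H -> K^o := fun h => (c h).1.
have phi0_lin : linear phi0.
  move=> k g h; apply: (c_uniq _ _ (k * (c g).2 + (c h).2)).
  by rewrite actl !cP scalerDr !scalerA addrACA -!scalerDl.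
pose phiL := HB.pack_for {linear H -> K^o} phi0
  (GRing.isLinear.Build _ _ _ _ _ phi0_lin).
pose phi : 'Hom(H, K^o) := linfun phiL.
have phiE h : phi h = (c h).1 by rewrite lfunE.
have phiI : (I <= lker phi)%VS.
  apply/subvP=> h hI; rewrite memv_ker phiE (c_uniq h 0 0) //.
  by rewrite I0 // !scale0r addr0.
apply: (hopf_ideal_eq0 two_neq0 m_gt0 HA m_odd w_prim HI phiI) => e k s.
rewrite phiE; set d := (-1) ^+ e * (if s then w^-1 else w) ^+ k.
apply: (c_uniq _ _ (if s then d else 0)).
rewrite /normal_form actM.
have tu : act (sp * sm) u = w *: u by rewrite actM mu (act_scale MA) pv.
have tv : act (sp * sm) v = w^-1 *: v by rewrite actM mv (act_scale MA) pu.
have Nu : act a u = (-1) *: u by rewrite au scaleN1r.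
have Nv : act a v = (-1) *: v by rewrite av scaleN1r.
have eigenM x z : act a x = (-1) *: x -> act (sp * sm) x = z *: x ->
    act (a ^+ e * (sp * sm) ^+ k) x = ((-1) ^+ e * z ^+ k) *: x.
  move=> ax tx; rewrite actM (act_eigenX MA _ tx) (act_scale MA).
  by rewrite (act_eigenX MA _ ax) scalerA mulrC.
case: (s) @d => d.
  by rewrite expr1 pu (eigenM _ _ Nv tv) scale0r add0r.
by rewrite expr0 act1 (eigenM _ _ Nu tu) scale0r addr0.
Qed.

End Faithful.

Theorem theorem5p5 (R : realType) (m i : nat) (delta : R[i])
  (H : hopfAlgebra R[i]) (a sp sm : H)
  (A : algType R[i]) (gr : nat -> {pred A}) (act : H -> A -> A) (u v : A)
  (m_ge2 : (2 <= m)%N) (m_odd : odd m)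
  (i_range : (1 <= i <= (m - 1) %/ 2)%N)
  (delta_sign : delta = 1 \/ delta = -1)
  (H_A4m : is_A4m m a sp sm)
  (A_graded : graded gr) (A_gen : generates [:: u; v])
  (A1_basis : ordered_basis2 (gr 1%N) u v)
  (A_modalg : module_algebra act)
  (act_graded : forall n h x, x \in gr n -> act h x \in gr n)
  (A1_pi : pi_action m i delta a sp sm act u v) :
  inner_faithful act <-> delta = -1 /\ coprime i m.
Proof.
have m_gt0 : (0 < m)%N by apply: leq_trans m_ge2.
have two_neq0 : 2%:R != 0 :> R[i] by rewrite pnatr_eq0.
have l_prim := lambda_primitive R m_gt0.
have [pu pv mu mv au av] := A1_pi.
split=> [faithful|[d1 im] I HI I0]; last first.
  apply: (annihilating_hopf_ideal_eq0 two_neq0 m_gt0 H_A4m m_odd _ A_modalg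
    A1_basis _ _ _ pu pv mu mv HI I0) => //.
  - by rewrite prim_root_exp_coprime.
  - by move=> h x; apply: act_graded.
  - by rewrite au d1 scaleN1r.
  - by rewrite av d1 scaleN1r.
have [wa wp wm] := word_gens a sp sm.
have gI (g h : H) : h * (g - 1) \in limg (amulr (g - 1)).
  by apply/memv_imgP; exists h; rewrite ?memvf // lfunE.
split.
  case: delta_sign => // d1; case: (A4m_a_neq1 two_neq0 H_A4m).
  apply: (inner_faithful_fixing_word two_neq0 H_A4m A_modalg A_gen
    wa _ _ _ faithful).
  - by rewrite -[X in X \in _]mul1r gI.
  - move=> x _; have -> : (a - 1) * x = x * (a - 1).
      by rewrite mulrBl mulrBr (a_central H_A4m) mul1r mulr1.
    exact: gI.
  - by move=> x; rewrite !inE => /orP[] /eqP ->; rewrite ?au ?av d1 scale1r.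
(* t^n is the smallest power of t that fixes u and v. *)
pose n := (m %/ gcdn i m)%N; set t := sp * sm.
have m_in : (m %| i * n)%N.
  rewrite /n muln_divA ?dvdn_gcdr // mulnC -muln_divA ?dvdn_gcdl //.
  exact: dvdn_mulr.
suff m_n : (m %| n)%N.
  have g_gt0 : (0 < gcdn i m)%N by rewrite gcdn_gt0 m_gt0 orbT.
  have n_gt0 : (0 < n)%N by rewrite divn_gt0 // dvdn_leq // dvdn_gcdr.
  have := dvdn_leq n_gt0 m_n; rewrite /coprime.
  case: (gcdn i m) @n g_gt0 {m_in m_n n_gt0} => [|[|d]] //= _.
  by rewrite leqNgt ltn_Pdiv.
apply: (A4m_rot_order m_gt0 H_A4m l_prim).
have [_ _ _ actM _ _] := A_modalg.
have [_ _ mm] := A4m_inv H_A4m.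
have t't : (sm * sp) ^+ n * t ^+ n = 1.
  have spm := A4m_spm (A4m_rel H_A4m).
  rewrite -(rotV m_gt0 H_A4m) -exprM -exprD -mulSnr prednK //.
  by rewrite exprM spm expr1n.
have t'E : (sm * sp) ^+ n - 1 = - (sm * sp) ^+ n * (t ^+ n - 1).
  by rewrite mulNr mulrBr t't mulr1 opprB.
(* Conjugation by s_+ or by s_- inverts t. *)
have swap x : x * (sm * sp) = t * x ->
    (t ^+ n - 1) * x \in limg (amulr (t ^+ n - 1)).
  move=> xt; rewrite mulrBl -(intertwineX n xt) mul1r -{2}[x]mulr1 -mulrBr.
  by rewrite t'E mulrA gI.
have tu : act t u = lambda R m ^+ i *: u.
  by rewrite actM mu (act_scale A_modalg) pv.
have tv : act t v = lambda R m ^- i *: v.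
  by rewrite actM mv (act_scale A_modalg) pu.
have lin1 : lambda R m ^+ i ^+ n = 1.
  by apply/eqP; rewrite -exprM -(prim_order_dvd l_prim).
apply: (inner_faithful_fixing_word two_neq0 H_A4m A_modalg A_gen
  (wordX n (wordM wp wm)) _ _ _ faithful).
- by rewrite t'E gI.
- move=> x; rewrite !inE => /or3P[] /eqP ->.
  + by rewrite -[X in X \in _](commrB (a_central H_A4m _) (commr1 a)) gI.
  + by apply: swap; rewrite mulrA.
  + by apply: swap; rewrite mulrA mm mul1r -mulrA mm mulr1.
move=> x; rewrite !inE => /orP[] /eqP ->.
  by rewrite (act_eigenX A_modalg _ tu) lin1 scale1r.
by rewrite (act_eigenX A_modalg _ tv) exprVn lin1 invr1 scale1r.
Qed.
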